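(* For all finite sets $A$ of integers, $|A|\,|A+A|\le|A+2\cdot A|^2$.
   Context: For $A\subset\mathbb{Z}$ and an integer $k$, $A+k\cdot A=\{a+kb:a,b\in A\}$; $A+A$ is the case $k=1$. *)

(* Defs.v *)
From mathcomp Require Import all_boot all_order all_algebra.
From mathcomp Require Import finmap.

Set Implicit Arguments.
Unset Strict Implicit.
Unset Printing Implicit Defensive.

(* [A + k . A], where [k . A] is the dilate [{k b : b in A}], not a k-fold sumset. *)
Definition sum_dilate (A : {fset int}) (k : int) : {fset int} :=
  [fset (a + k * b)%R | a in A, b in A]%fset.

(* Main.v *)
Require Import Defs.
From mathcomp Require Import all_boot all_order all_algebra.
From mathcomp Require Import finmap.
From mathcomp Require Import zify.

(** The statement is the case [X = 2 . A], [Y = Z = A] of Ruzsa's triangle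
    inequality for sums, [|X| |Y + Z| <= |X + Y| |X + Z|], since [2 . A] has as
    many elements as [A].

    Ruzsa's inequality is proved by Petridis' method.  [X] contains a nonempty
    set [S] whose ratio [K = |S + Y| / |S|] is at most that of [X] and at most
    that of every subset of [S] ([exists_min_ratio]).  Such an [S] satisfies
    [|S + Y + C| <= K |S + C|] for every finite [C]
    ([card_sumset_min_ratio]), so that
    [|Y + Z| <= |S + Y + Z| <= K |S + Z| <= (|X + Y| / |X|) |X + Z|].
    Ratios are compared by cross-multiplication in the natural numbers. *)

Import GRing.Theory.

Section Sumsets.
Local Open Scope fset_scope.
Local Open Scope ring_scope.
Variable V : zmodType.
Implicit Types (X Y Z C D S W : {fset V}).

Definition sumset X Y : {fset V} :=
  [fset x + y | x in X, y in Y].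

Lemma sumsetP X Y (v : V) :
  reflect (exists x y, [/\ x \in X, y \in Y & v = x + y]) (v \in sumset X Y).
Proof.
apply: (iffP (imfset2P _ _ _ _ _)) => [[x xX [y yY ->]]|[x [y [xX yY ->]]]].
  by exists x, y.
by exists x => //; exists y.
Qed.

Arguments sumsetP {X Y v}.

Lemma mem_sumset X Y x y : x \in X -> y \in Y -> x + y \in sumset X Y.
Proof. by move=> xX yY; apply/sumsetP; exists x, y. Qed.

Lemma sumset0 X : sumset X fset0 = fset0.
Proof. by apply/fsetP => v; apply/sumsetP; rewrite inE => -[x [y []]]. Qed.

Lemma sumsetA X Y Z : sumset X (sumset Y Z) = sumset (sumset X Y) Z.
Proof.
apply/fsetP => v; apply/sumsetP/sumsetP.
  move=> [x [_ [xX /sumsetP[y [z [yY zZ ->]]] ->]]].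
  by exists (x + y), z; rewrite mem_sumset // addrA.
move=> [_ [z [/sumsetP[x [y [xX yY ->]]] zZ ->]]].
by exists x, (y + z); rewrite mem_sumset // addrA.
Qed.

Lemma sumsetC X Y : sumset X Y = sumset Y X.
Proof.
by apply/fsetP => v; apply/sumsetP/sumsetP => -[x [y [xX yY ->]]];
  exists y, x; rewrite addrC.
Qed.

Lemma sumsetSl X X' Y : X `<=` X' -> sumset X Y `<=` sumset X' Y.
Proof.
move=> /fsubsetP sXX'; apply/fsubsetP => _ /sumsetP[x [y [/sXX' xX yY ->]]].
exact: mem_sumset.
Qed.

Lemma sumsetUr X C D : sumset X (C `|` D) = sumset X C `|` sumset X D.
Proof.
apply/fsetP => v; rewrite in_fsetU; apply/sumsetP/orP.
  move=> [x [y [xX + ->]]]; rewrite in_fsetU => /orP[] yC; [left|right];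
  exact: mem_sumset.
by case=> /sumsetP[x [y [xX yC ->]]]; exists x, y; rewrite in_fsetU yC ?orbT.
Qed.

Lemma card_sumset1 X c : #|` sumset X [fset c]| = #|` X|.
Proof.
have -> : sumset X [fset c] = [fset x + c | x in X].
  apply/fsetP => v; apply/sumsetP/imfsetP => /=.
    by move=> [x [y [xX /fset1P -> ->]]]; exists x.
  by move=> [x xX ->]; exists x, c; rewrite fset11.
exact: (card_imfset _ _ (addIr c)).
Qed.

Lemma leq_card_sumset X Y : X != fset0 -> (#|` Y| <= #|` sumset X Y|)%N.
Proof.
move=> /fset0Pn[x xX]; rewrite -(card_sumset1 Y x) sumsetC.
by apply/fsubset_leq_card/sumsetSl; rewrite fsub1set.
Qed.

(** Adjoining [c] to [C] adds at most one translate of [S + Y]; the part of it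
    that comes from those [s] with [s + Y + c] inside [S + Y + C] is not new.
    The same subset [W] of [S] bounds from below the growth of [S + C], because
    [s + c \in S + C] implies [s + Y + c <= S + Y + C]. *)
Lemma card_sumset_fset1U S Y C c :
  exists2 W, W `<=` S &
    (#|` sumset (sumset S Y) (c |` C)| + #|` sumset W Y|
       <= #|` sumset (sumset S Y) C| + #|` sumset S Y|)%N /\
    (#|` sumset S C| + #|` S| <= #|` sumset S (c |` C)| + #|` W|)%N.
Proof.
pose T := sumset (sumset S Y) C.
pose W := [fset s in S | sumset (sumset [fset s] Y) [fset c] `<=` T].
have sWS : W `<=` S by apply/fsubsetP => s; rewrite !inE => /andP[].
exists W => //; rewrite ![c |` C]fsetUC !sumsetUr; split.
- rewrite -(card_sumset1 (sumset S Y) c) -(card_sumset1 (sumset W Y) c) -/T.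
  rewrite -[leqRHS]cardfsUI leq_add2l; apply/fsubset_leq_card/fsubsetP => v.
  move=> /sumsetP[_ [d [/sumsetP[w [y [wW yY ->]]] dc ->]]].
  rewrite in_fsetI; apply/andP; split.
    move: wW; rewrite !inE => /andP[_ /fsubsetP]; apply.
    by rewrite !mem_sumset ?fset11.
  by rewrite !mem_sumset // (fsubsetP sWS).
- rewrite -(card_sumset1 S c) -(card_sumset1 W c) -[leqLHS]cardfsUI leq_add2l.
  apply/fsubset_leq_card/fsubsetP => v; rewrite in_fsetI andbC.
  move=> /andP[/sumsetP[s [d [sS /fset1P -> ->]]] scSC].
  apply: mem_sumset; last by rewrite fset11.
  rewrite !inE sS /=; apply/fsubsetP => u.
  move=> /sumsetP[_ [_ [/sumsetP[_ [y [/fset1P -> yY ->]]] /fset1P -> ->]]].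
  rewrite addrAC; case/sumsetP: scSC => a [b [aS bC ->]].
  by rewrite addrAC !mem_sumset.
Qed.

(** Petridis' lemma.  Write [K = |S + Y| / |S|].  When [c] joins [C],
    [card_sumset_fset1U] bounds the growth of [S + Y + C] by [|S + Y| - |W + Y|]
    and that of [S + C] from below by [|S| - |W|]; since [|W + Y| >= K |W|], the
    former is at most [K] times the latter. *)
Lemma card_sumset_min_ratio S Y C :
    (forall W, W `<=` S ->
       #|` sumset S Y| * #|` W| <= #|` sumset W Y| * #|` S|)%N ->
  (#|` sumset (sumset S Y) C| * #|` S| <= #|` sumset S Y| * #|` sumset S C|)%N.
Proof.
move=> minS; elim/finSet_rect: C => C IH.
have [->|[c cC]] := fset_0Vmem C; first by rewrite !sumset0 cardfs0.
have := IH _ (fproperD1 cC); rewrite -{3 4}(fsetD1K cC).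
have [W sWS [le1 le2]] := card_sumset_fset1U S Y (C `\ c) c.
have := minS _ sWS; nia.
Qed.

(** Descent: if some subset of [X] has a smaller ratio [|W + Y| / |W|] than [X],
    replace [X] by it and repeat.  Cross-multiplied, the comparison fails for an
    empty [W], so the descent stays among nonempty sets. *)
Lemma exists_min_ratio X Y : X != fset0 ->
  exists S, [/\ S `<=` X, S != fset0,
    (forall W, W `<=` S ->
       #|` sumset S Y| * #|` W| <= #|` sumset W Y| * #|` S|)%N &
    (#|` sumset S Y| * #|` X| <= #|` sumset X Y| * #|` S|)%N].
Proof.
elim/finSet_rect: X => X IH X0.
pose worse W := (#|` sumset W Y| * #|` X| < #|` sumset X Y| * #|` W|)%N.
have [/hasP[W]|/hasPn minX] := boolP (has worse (fpowerset X)); last first.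
  exists X; split=> // W sWX; rewrite leqNgt; apply: minX.
  by rewrite fpowersetE.
rewrite fpowersetE /worse => sWX ltWX.
have W0 : W != fset0.
  by apply: contraTneq ltWX => ->; rewrite cardfs0 muln0.
have prWX : W `<` X.
  by rewrite fproperEneq sWX andbT; apply: contraTneq ltWX => ->; rewrite ltnn.
have [S [sSW S0 minS leSW]] := IH W prWX W0.
exists S; split=> //; first exact: fsubset_trans sWX.
move: W0; rewrite -cardfs_gt0 => W0.
(* transitivity of the comparison of ratios, with the common factor [|W|] *)
rewrite -(leq_pmul2r W0); nia.
Qed.

(** A set [S] as above gives the constant [K]; passing from [Y + Z] to
    [S + Y + Z] only enlarges the set, as [S] is nonempty. *)
Lemma ruzsa_triangle_sum X Y Z :
  (#|` X| * #|` sumset Y Z| <= #|` sumset X Y| * #|` sumset X Z|)%N.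
Proof.
have [->|X0] := eqVneq X fset0; first by rewrite cardfs0.
have [S [sSX S0 minS leSX]] := exists_min_ratio X Y X0.
have le1 := leq_card_sumset S (sumset Y Z) S0.
rewrite sumsetA in le1.
have le2 := card_sumset_min_ratio S Y Z minS.
have le3 : (#|` sumset S Z| <= #|` sumset X Z|)%N.
  exact/fsubset_leq_card/sumsetSl.
rewrite -cardfs_gt0 in S0; rewrite -(leq_pmul2r S0) -mulnA.
apply: leq_trans (leq_mul (leqnn _) (leq_mul le1 (leqnn _))) _.
apply: leq_trans (leq_mul (leqnn _) le2) _.
by rewrite mulnA [leqRHS]mulnAC leq_mul // mulnC.
Qed.

End Sumsets.

Arguments sumset {V} X Y.
Arguments sumsetP {V X Y v}.

Lemma sum_dilateE (A : {fset int}) (k : int) :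
  sum_dilate A k = sumset A [fset (k * a)%R | a in A]%fset.
Proof.
apply/fsetP => v; apply/imfset2P/sumsetP => /=.
  move=> [a aA [b bA ->]]; exists a, (k * b)%R; split=> //.
  by apply/imfsetP; exists b.
move=> [a [_ [aA /imfsetP[b /= bA ->] ->]]].
by exists a => //; exists b.
Qed.

Theorem theorem13 (A : {fset int}) :
  (#|` A| * #|` sum_dilate A 1| <= #|` sum_dilate A 2| ^ 2)%N.
Proof.
have A1 : [fset (1 * a)%R | a in A]%fset = A.
  apply/fsetP => v; apply/imfsetP/idP => /= [[a aA ->]|vA].
    by rewrite mul1r.
  by exists v; rewrite ?mul1r.
have card2A : #|` [fset (2 * a)%R | a in A]%fset| = #|` A|.
  by apply: card_imfset; apply: mulfI.
rewrite !sum_dilateE A1 -{1}card2A -mulnn.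
rewrite [sumset A [fset (2 * a)%R | a in A]%fset]sumsetC.
exact: ruzsa_triangle_sum.
Qed.
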